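(* Let $(X,d)$ be a complete ultrametric space. If $f:X\to X$ is an eventually $1$-Lipschitz map, then $f$ has the shadowing property.
   Context: An ultrametric space satisfies $d(x,z)\le\max\{d(x,y),d(y,z)\}$ for all $x,y,z$. A map $f:X\to X$ is eventually Lipschitz $L$ if there is $\varepsilon>0$ such that $d(f(x),f(y))\le L\,d(x,y)$ whenever $d(x,y)<\varepsilon$. Shadowing property: for every $\varepsilon>0$ there is $\delta>0$ such that every sequence $(x_n)_{n\in\mathbb{N}}$ with $d(f(x_n),x_{n+1})<\delta$ for all $n$ admits $x\in X$ with $d(f^n(x),x_n)<\varepsilon$ for all $n\in\mathbb{N}$. *)

(* Defs.v *)
From Stdlib Require Import Reals.
Open Scope R_scope.

Definition is_metric {X : Type} (d : X -> X -> R) : Prop :=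
  (forall x y, 0 <= d x y) /\
  (forall x y, d x y = 0 <-> x = y) /\
  (forall x y, d x y = d y x) /\
  (forall x y z, d x z <= d x y + d y z).

Definition is_ultrametric {X : Type} (d : X -> X -> R) : Prop :=
  is_metric d /\ forall x y z, d x z <= Rmax (d x y) (d y z).

Definition cauchy_seq {X : Type} (d : X -> X -> R) (u : nat -> X) : Prop :=
  forall eps, 0 < eps -> exists N, forall m n, (N <= m)%nat -> (N <= n)%nat ->
    d (u m) (u n) < eps.

Definition converges_to {X : Type} (d : X -> X -> R) (u : nat -> X) (l : X) : Prop :=
  forall eps, 0 < eps -> exists N, forall n, (N <= n)%nat -> d (u n) l < eps.

Definition complete {X : Type} (d : X -> X -> R) : Prop :=
  forall u : nat -> X, cauchy_seq d u -> exists l, converges_to d u l.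

Definition eventually_lipschitz {X : Type} (d : X -> X -> R) (f : X -> X) (L : R) : Prop :=
  exists eps, 0 < eps /\
    forall x y, d x y < eps -> d (f x) (f y) <= L * d x y.

Definition shadowing {X : Type} (d : X -> X -> R) (f : X -> X) : Prop :=
  forall eps, 0 < eps -> exists delta, 0 < delta /\
    forall xs : nat -> X,
      (forall n, d (f (xs n)) (xs (S n)) < delta) ->
      exists x, forall n, d (Nat.iter n f x) (xs n) < eps.

(* Main.v *)
Require Import Defs.
From Stdlib Require Import Reals Lra.
Open Scope R_scope.

(* Below the Lipschitz radius r, the strong triangle inequality makes every
   ball of radius delta <= r forward invariant up to a delta-jump: if y is
   delta-close to x_n, then f y is delta-close to f x_n, hence to x_(n+1).
   So the true orbit of x_0 delta-shadows every delta-pseudo-orbit. *)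

Section UltrametricShadowing.

Variables (X : Type) (d : X -> X -> R) (f : X -> X).
Hypothesis d_ultra : is_ultrametric d.

Lemma ultrametric_refl (x : X) : d x x = 0.
Proof. destruct d_ultra as [[_ [d_eq0 _]] _]. apply d_eq0. reflexivity. Qed.

Lemma ultrametric_lt_max (x y z : X) (delta : R) :
  d x y < delta -> d y z < delta -> d x z < delta.
Proof.
  intros Hxy Hyz. destruct d_ultra as [_ d_max].
  eapply Rle_lt_trans; [apply (d_max x y z) | apply Rmax_lub_lt; assumption].
Qed.

Variables (r L : R).
Hypothesis L_le1 : L <= 1.
Hypothesis f_lip : forall x y, d x y < r -> d (f x) (f y) <= L * d x y.

Lemma ultrametric_pseudo_orbit_step (y x x' : X) (delta : R) :
  delta <= r -> d y x < delta -> d (f x) x' < delta -> d (f y) x' < delta.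
Proof.
  intros Hdelta Hyx Hfx.
  apply (ultrametric_lt_max _ (f x)); [| exact Hfx].
  assert (Hf : d (f y) (f x) <= L * d y x) by (apply f_lip; lra).
  assert (Hpos : 0 <= d y x) by (destruct d_ultra as [[d_ge0 _] _]; apply d_ge0).
  nra.
Qed.

Lemma orbit_shadows_pseudo_orbit (delta : R) (xs : nat -> X) :
  0 < delta -> delta <= r ->
  (forall n, d (f (xs n)) (xs (S n)) < delta) ->
  forall n, d (Nat.iter n f (xs O)) (xs n) < delta.
Proof.
  intros Hdelta Hr Hxs n. induction n as [|n IH].
  - simpl. rewrite ultrametric_refl. exact Hdelta.
  - exact (ultrametric_pseudo_orbit_step _ _ _ _ Hr IH (Hxs n)).
Qed.

End UltrametricShadowing.

Theorem corollary5p3 (X : Type) (d : X -> X -> R) (f : X -> X) :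
  is_ultrametric d -> complete d -> eventually_lipschitz d f 1 ->
  shadowing d f.
Proof.
  intros d_ultra _ [r [Hr f_lip]] eps Heps.
  exists (Rmin eps r). split; [apply Rmin_glb_lt; assumption |].
  intros xs Hxs. exists (xs O). intros n.
  apply (Rlt_le_trans _ (Rmin eps r)); [| apply Rmin_l].
  apply (orbit_shadows_pseudo_orbit X d f d_ultra r 1 (Rle_refl 1) f_lip); auto.
  - apply Rmin_glb_lt; assumption.
  - apply Rmin_r.
Qed.
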